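(* The set $\Omega^\Gamma\in\Xi$ is a stationary point for $J_\infty(\cdot)$ in $\mathcal H(\Omega,\mathbb R^2)$, that is, $dJ_\infty(\Omega^\Gamma)(X)\ge0$ for all $X\in\mathcal H(\Omega,\mathbb R^2)$, if and only if $0\in\bar L(\Omega^\Gamma)$.
   Context: Geometry. $D\subset\mathbb R^2$ is a fixed open bounded set. For $\Omega\subset\mathbb R^2$, $\Gamma\subset\partial\Omega$, the set $\Omega\cup\Gamma$ is regular (in the sense of Gröger) if $\Omega$ is a bounded Lipschitz domain, $\Gamma$ is relatively open in $\partial\Omega$, $\Gamma_0:=\partial\Omega\setminus\Gamma$ has positive measure, and $\Gamma_0$ is a finite union of closed and non-degenerate curved pieces of $\partial\Omega$. $\Xi:=\{(\Omega,\Gamma):\Omega\subset D,\ \Gamma\subset\partial\Omega,\ \Omega\cup\Gamma\text{ regular}\}$, $\Omega^\Gamma:=(\Omega,\Gamma)$. Spaces. $W^1_{\Gamma,p}(\Omega)$ is the closure in $W^1_p(\Omega)$ of $\{f|_\Omega:f\in C^\infty(\mathbb R^2),\ \operatorname{supp}f\cap\Gamma_0=\emptyset\}$, $W^{-1}_{\Gamma,p}(\Omega):=(W^1_{\Gamma,p'}(\Omega))^*$, $1/p+1/p'=1$. $Lu:=(u,\nabla u)^\top$. Data. $\beta\in C^1(\mathbb R)$ satisfies: $\bar\beta\le\beta\le\underline\beta$ for some constants $\bar\beta,\underline\beta>0$; $(\beta(x)-\beta(y))(x-y)\ge0$ for all $x,y\in\mathbb R$; there are $k,K>0$ with $k|\eta|^2\le\beta(|p|^2)|\eta|^2+2\beta'(|p|^2)|p\cdot\eta|^2\le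 K|\eta|^2$ for all $\eta,p\in\mathbb R^2$. $f\in W^1_q(D)$; $\Psi:\mathbb R^2\times\mathbb R\to\mathbb R$ is continuously differentiable, $\nabla_y\Psi$ being its gradient in the first variable and $\partial_\zeta\Psi$ its derivative in the second. Exponent. $2<q<q_0$, where $q_0>2$ is fixed as follows. Let $\langle\mathcal Jv,w\rangle:=\int_\Omega\nabla v\cdot\nabla w+vw\,dx$, $M_p:=\sup\{\|v\|_{W^1_p(\Omega)}:v\in W^1_{\Gamma,p}(\Omega),\ \|\mathcal Jv\|_{W^{-1}_{\Gamma,p}(\Omega)}\le1\}$ with $\|v\|_{W^1_p(\Omega)}=\|\,|Lv|\,\|_{L_p(\Omega)}$, and $\Omega^\Gamma\in R_p$ if $\mathcal J$ maps $W^1_{\Gamma,p}(\Omega)$ onto $W^{-1}_{\Gamma,p}(\Omega)$; then $q_0>2$ satisfies $\Omega^\Gamma\in R_{q_0}$ and $M_q(1-m^2/M^2)^{1/2}<1$ for all $q\in[2,q_0]$, where $m=\min\{k,1\}$, $M=\max\{K,1\}$. State, adjoint. $u\in W^1_{\Gamma,q}(\Omega)\subset C(\overline\Omega)$ is the unique solution of $\int_\Omega\beta(|\nabla u|^2)\nabla u\cdot\nabla\varphi+u\varphi\,dx=\int_\Omega f\varphi\,dx$ for all $\varphi\in W^1_{\Gamma,q'}(\Omega)$. With $a(x,\zeta):=(\zeta_0,\beta(|\hat\zeta|^2)\hat\zeta)^\top$ for $\zeta=(\zeta_0,\hat\zeta)\in\mathbb R^3$ and $b(x,u):=\partial_\zeta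 a(x,Lu(x))$, for $y\in\overline\Omega$ the adjoint state $p_y\in W^1_{\Gamma,q'}(\Omega)$ solves $\int_\Omega b(x,u)Lp_y\cdot L\varphi\,dx=-\partial_\zeta\Psi(y,u(y))\varphi(y)$ for all $\varphi\in W^1_{\Gamma,q}(\Omega)$. Derivatives. $J_\infty(\Omega^\Gamma):=\max_{x\in\overline\Omega}\Psi(x,u(x))$, $R(\Omega^\Gamma):=\{x\in\overline\Omega:\Psi(x,u(x))=J_\infty(\Omega^\Gamma)\}$. For $y\in\overline\Omega$, $$dj(\Omega^{\Gamma,y})(X)=\int_\Omega\mathbf S_1(u,p_y):\partial X+\mathbf S_0(u,p_y)\cdot X\,dx+X(y)\cdot\nabla_y\Psi(y,u(y)),$$ $\mathbf S_1(u,p)=(\beta(|\nabla u|^2)\nabla u\cdot\nabla p+up-fp)I-\beta(|\nabla u|^2)(\nabla u\otimes\nabla p+\nabla p\otimes\nabla u)-2\beta'(|\nabla u|^2)(\nabla u\cdot\nabla p)\nabla u\otimes\nabla u$, $\mathbf S_0(u,p)=-\nabla f\,p$. Hilbert space. $\mathcal H(\Omega,\mathbb R^2)$ is a fixed real Hilbert space with inner product $(\cdot,\cdot)_{\mathcal H}$, contained in the space $\mathring C^{0,1}(D,\mathbb R^2)$ of Lipschitz functions on $\overline D$ vanishing on $\partial D$, such that $X\mapsto a\cdot X(y)$ is continuous on it for all $a\in\mathbb R^2$ and all $y$. $\nabla j(\Omega^{\Gamma,y})\in\mathcal H(\Omega,\mathbb R^2)$ is the Riesz representative: $(\nabla j(\Omega^{\Gamma,y}),\varphi)_{\mathcal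 H}=dj(\Omega^{\Gamma,y})(\varphi)$ for all $\varphi\in\mathcal H(\Omega,\mathbb R^2)$. The Eulerian semi-derivative of $J_\infty$ is given on $\mathcal H(\Omega,\mathbb R^2)$ by $dJ_\infty(\Omega^\Gamma)(X)=\max_{y\in R(\Omega^\Gamma)}(\nabla j(\Omega^{\Gamma,y}),X)_{\mathcal H}$. $H(\Omega^\Gamma):=\{\nabla j(\Omega^{\Gamma,y}):y\in R(\Omega^\Gamma)\}$; $L(\Omega^\Gamma)$ is the convex hull of $H(\Omega^\Gamma)$ and $\bar L(\Omega^\Gamma)$ its closure in $\mathcal H(\Omega,\mathbb R^2)$. *)

(* Defs.v *)
(* Mathematical Components / MathComp-Analysis, over an abstract R : realType. *)
From HB Require Import structures.
From mathcomp Require Import all_boot all_order all_algebra.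
From mathcomp Require Import all_classical all_reals all_analysis.

Set Implicit Arguments.
Unset Strict Implicit.
Unset Printing Implicit Defensive.
Import Order.TTheory GRing.Theory Num.Theory.
Import numFieldNormedType.Exports.
Local Open Scope classical_set_scope.
Local Open Scope ring_scope.

(* The plane is R * R. Its library norm is the max norm, so Euclidean lengths
   are always written with [enorm]; the topology is the usual one. *)
Notation plane R := (R * R)%type.

Section Plane.
Variable R : realType.
Implicit Types (x y : plane R) (A : set (plane R)).

Definition dot x y : R := x.1 * y.1 + x.2 * y.2.

Definition enorm x : R := Num.sqrt (dot x x).

Definition coord (i : 'I_2) x : R := if i == ord0 then x.1 else x.2.

Definition basis (i : 'I_2) : plane R :=
  if i == ord0 then (1, 0) else (0, 1).

Definition area :
    {measure set (measurableTypeR R * measurableTypeR R) -> \bar R} :=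
  ((@lebesgue_measure R) \x (@lebesgue_measure R))%E.

Definition frontier A := closure A `\` interior A.

Definition diam A : \bar R :=
  ereal_sup (0%E |` [set (enorm (z.1 - z.2))%:E | z in A `*` A]).

(* One-dimensional Hausdorff measure, i.e. arc length on curves. *)
Definition hausdorff1 A : \bar R :=
  ereal_sup [set ereal_inf
      [set (\sum_(0 <= n <oo) diam (U n))%E | U in
        [set U : nat -> set (plane R) |
          A `<=` \bigcup_n U n /\ forall n, (diam (U n) <= d%:E)%E]]
    | d in [set d : R | 0 < d]].

End Plane.

(* [Cn n g]: g is of class C^n on the finite-dimensional space E. *)
Fixpoint Cn (R : realType) (E : normedModType R) (n : nat) (g : E -> R) : Prop :=
  match n with
  | 0%N => continuous g
  | m.+1 => (forall x, differentiable g x) /\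
            (forall v, Cn m (fun x => ('d g x : E -> R) v))
  end.

Section Domains.
Variable R : realType.
Implicit Types (D Om Ga : set (plane R)).

(* Near each boundary point x0, in a rotated orthonormal frame (e, e') centred
   at x0, the set is the epigraph of a Lipschitz function. *)
Definition Lipschitz_boundary Om :=
  forall x0, frontier Om x0 ->
  exists (e : plane R) (r h : R) (g : R -> R),
    [/\ enorm e = 1, 0 < r /\ 0 < h, lipschitz g &
        forall s t, `|s| < r -> `|t| < h ->
          Om (x0 + s *: e + t *: (- e.2, e.1)) <-> g s < t].

Definition bounded_Lipschitz_domain Om :=
  [/\ open Om, connected Om, Om !=set0, bounded_set Om &
      Lipschitz_boundary Om].

(* A closed non-degenerate curved piece is a Jordan arc; an entire boundary
   component is the union of two of them. *)
Definition curved_piece Om (C : set (plane R)) :=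
  C `<=` frontier Om /\
  exists gam : R -> plane R,
    [/\ {within `[0, 1], continuous gam},
        (forall s t, 0 <= s <= 1 -> 0 <= t <= 1 -> gam s = gam t -> s = t) &
        C = gam @` `[0, 1]].

Definition Ga0 Om Ga := frontier Om `\` Ga.

Definition Groger_regular Om Ga :=
  [/\ bounded_Lipschitz_domain Om,
      (exists2 O : set (plane R), open O & Ga = O `&` frontier Om),
      (0 < hausdorff1 (Ga0 Om Ga))%E &
      exists (n : nat) (C : 'I_n -> set (plane R)),
        (forall i, curved_piece Om (C i)) /\
        Ga0 Om Ga = \bigcup_i C i].

Definition Xi D : set (set (plane R) * set (plane R)) :=
  [set OG | [/\ OG.1 `<=` D, OG.2 `<=` frontier OG.1 &
                Groger_regular OG.1 OG.2]].

End Domains.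

(* Elements of Sobolev spaces are represented by functions on the plane, of
   which only the values on Om, up to null sets, matter. *)
Section Sobolev.
Variable R : realType.
Implicit Types (Om Ga : set (plane R)) (p : R) (u v w : plane R -> R).

Definition support v := closure [set x | v x != 0].

Definition smooth v := forall n, Cn n v.

Definition test_function Om v :=
  [/\ smooth v, compact (support v) & support v `<=` Om].

Definition loc_integrable Om v :=
  forall K, compact K -> K `<=` Om -> (@area R).-integrable K (EFin \o v).

Definition is_weak_grad Om u (g : plane R -> plane R) :=
  loc_integrable Om u /\
  forall i : 'I_2, loc_integrable Om (fun x => coord i (g x)) /\
    forall phi, test_function Om phi ->
      \int[@area R]_(x in Om) (u x * ('d phi x : plane R -> R) (basis R i)) =
      - \int[@area R]_(x in Om) (coord i (g x) * phi x).

(* The weak gradient, unique almost everywhere in Om when it exists. *)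
Definition wgrad Om u : plane R -> plane R :=
  xget (fun=> 0) [set g | is_weak_grad Om u g].

Definition dot3 (z z' : R * plane R) : R := z.1 * z'.1 + dot z.2 z'.2.

Definition L Om u (x : plane R) : R * plane R := (u x, wgrad Om u x).

Definition W1norm Om p u : \bar R :=
  'N[@area R]_(p%:E)
    [EFin \o ((fun x => Num.sqrt (dot3 (L Om u x) (L Om u x))) \_ Om)]%E.

Definition W1 Om p : set (plane R -> R) :=
  [set u | [/\ measurable_fun Om u, (exists g, is_weak_grad Om u g) &
               (W1norm Om p u < +oo)%E]].

Definition W1Ga Om Ga p : set (plane R -> R) :=
  [set u | W1 Om p u /\
    forall e : R, 0 < e -> exists phi,
      [/\ smooth phi, support phi `&` Ga0 Om Ga = set0, W1 Om p phi &
          (W1norm Om p (fun x => u x - phi x)%R < e%:E)%E]].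

Definition dual_exp p : R := fine (hoelder_conjugate p%:E).

Definition dual_norm Om Ga p (F : (plane R -> R) -> R) : \bar R :=
  ereal_sup [set `|F w|%:E | w in
    [set w | W1Ga Om Ga (dual_exp p) w /\
             (W1norm Om (dual_exp p) w <= 1)%E]].

(* W^{-1}_{Ga,p}; only the values of F on W^1_{Ga,p'} matter. *)
Definition Wm1Ga Om Ga p : set ((plane R -> R) -> R) :=
  [set F | (forall (a : R) v w,
              W1Ga Om Ga (dual_exp p) v -> W1Ga Om Ga (dual_exp p) w ->
              F (fun x => a * v x + w x) = a * F v + F w) /\
           (dual_norm Om Ga p F < +oo)%E].

Definition Jop Om v w : R :=
  \int[@area R]_(x in Om) (dot (wgrad Om v x) (wgrad Om w x) + v x * w x).

Definition Mnorm Om Ga p : \bar R :=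
  ereal_sup [set W1norm Om p v | v in
    [set v | W1Ga Om Ga p v /\ (dual_norm Om Ga p (Jop Om v) <= 1)%E]].

Definition in_R Om Ga p :=
  forall F, Wm1Ga Om Ga p F ->
  exists2 v, W1Ga Om Ga p v &
    forall w, W1Ga Om Ga (dual_exp p) w -> Jop Om v w = F w.

End Sobolev.

Section Problem.
Variable R : realType.
Variables (D Om Ga : set (plane R)).
Variables (beta : R -> R) (f : plane R -> R) (Psi : plane R -> R -> R).
Variables (q : R) (u : plane R -> R).

Definition beta_conditions (blo bhi k K : R) :=
  [/\ Cn 1 beta,
      [/\ 0 < blo, 0 < bhi & forall s, blo <= beta s <= bhi],
      (forall x y, 0 <= (beta x - beta y) * (x - y)) &
      [/\ 0 < k, 0 < K & forall eta p : plane R,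
        let p2 := enorm p ^+ 2 in let eta2 := enorm eta ^+ 2 in
        k * eta2 <= beta p2 * eta2 + 2 * derive1 beta p2 * `|dot p eta| ^+ 2
                 <= K * eta2]].

Definition exponent_conditions (k K q0 : R) :=
  let m := Num.min k 1 in let M := Num.max K 1 in
  [/\ 2 < q0, in_R Om Ga q0 &
      forall p, 2 <= p <= q0 ->
        (Mnorm Om Ga p * (Num.sqrt (1 - m ^+ 2 / M ^+ 2))%:E < 1)%E].

(* Sobolev functions that are evaluated at points are represented by their
   continuous version on the closure of Om. *)
Definition is_state :=
  [/\ W1Ga Om Ga q u, {within closure Om, continuous u} &
      forall phi, W1Ga Om Ga (dual_exp q) phi ->
        \int[@area R]_(x in Om)
           (beta (enorm (wgrad Om u x) ^+ 2) *
              dot (wgrad Om u x) (wgrad Om phi x) + u x * phi x) =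
        \int[@area R]_(x in Om) (f x * phi x)].

Definition aop (z : R * plane R) : R * plane R :=
  (z.1, beta (enorm z.2 ^+ 2) *: z.2).

Definition bop (x : plane R) : R * plane R -> R * plane R :=
  'd aop (L Om u x).

Definition dzeta_Psi (y : plane R) (z : R) : R := derive1 (Psi y) z.

Definition nabla_Psi (y : plane R) (z : R) : plane R :=
  ('D_(basis R ord0) (fun x => Psi x z) y,
   'D_(basis R ord_max) (fun x => Psi x z) y).

Definition is_adjoint (y : plane R) (p : plane R -> R) :=
  W1Ga Om Ga (dual_exp q) p /\
  forall phi, W1Ga Om Ga q phi -> {within closure Om, continuous phi} ->
    \int[@area R]_(x in Om) dot3 (bop x (L Om p x)) (L Om phi x) =
    - dzeta_Psi y (u y) * phi y.

(* A maximum, since closure Om is compact and Psi and u are continuous. *)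
Definition Jinfty : R := sup [set Psi x (u x) | x in closure Om].

Definition active_set : set (plane R) :=
  [set x | closure Om x /\ Psi x (u x) = Jinfty].

Definition tensor (a b : plane R) : 'M[R]_2 :=
  \matrix_(i, j) (coord i a * coord j b).

Definition frob (A B : 'M[R]_2) : R := \sum_i \sum_j A i j * B i j.

(* Classical Jacobian; exists almost everywhere for Lipschitz X. *)
Definition jacobian (X : plane R -> plane R) (x : plane R) : 'M[R]_2 :=
  \matrix_(i, j) 'D_(basis R j) (fun z => coord i (X z)) x.

Definition S1 (p : plane R -> R) (x : plane R) : 'M[R]_2 :=
  let gu := wgrad Om u x in let gp := wgrad Om p x in
  let g2 := enorm gu ^+ 2 in
  (beta g2 * dot gu gp + u x * p x - f x * p x)%:M
  - beta g2 *: (tensor gu gp + tensor gp gu)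
  - (2 * derive1 beta g2 * dot gu gp) *: tensor gu gu.

Definition S0 (p : plane R -> R) (x : plane R) : plane R :=
  - (p x *: wgrad D f x).

Definition dj (y : plane R) (p : plane R -> R) (X : plane R -> plane R) : R :=
  \int[@area R]_(x in Om) (frob (S1 p x) (jacobian X x) + dot (S0 p x) (X x))
  + dot (X y) (nabla_Psi y (u y)).

End Problem.

Section Hilbert.
Variable R : realType.

Definition Hilbert_product (V : completeNormedModType R) (ip : V -> V -> R) :=
  [/\ forall v w, ip v w = ip w v,
      forall (a : R) v v' w, ip (a *: v + v') w = a * ip v w + ip v' w &
      forall v, ip v v = `|v| ^+ 2].

(* [ev] exhibits the elements of V as Lipschitz vector fields on closure D that
   vanish on the boundary of D; its values outside closure D are irrelevant. *)
Definition Lipschitz_field_space (D : set (plane R))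
    (V : completeNormedModType R) (ev : V -> plane R -> plane R) :=
  [/\ forall (a : R) X Y x, closure D x -> ev (a *: X + Y) x = a *: ev X x + ev Y x,
      forall X Y, (forall x, closure D x -> ev X x = ev Y x) -> X = Y,
      forall X, [lipschitz ev X x | x in closure D],
      forall X x, frontier D x -> ev X x = 0 &
      forall (a y : plane R), closure D y ->
        continuous (fun X => dot a (ev X y))].

Definition convex_hull (V : lmodType R) (A : set V) : set V :=
  [set v | exists (n : nat) (c : 'I_n -> R) (z : 'I_n -> V),
    [/\ forall i, 0 <= c i, \sum_i c i = 1, forall i, A (z i) &
        v = \sum_i c i *: z i]].

(* The Eulerian semi-derivative of the maximum functional, from the gradients
   gj y, y ranging over the active set RO. It is the maximum of ip (gj y) X over
   y in RO; [sup] is that maximum as soon as it is attained. *)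
Definition dJinfty (V : completeNormedModType R) (ip : V -> V -> R)
    (RO : set (plane R)) (gj : plane R -> V) (X : V) : R :=
  sup [set ip (gj y) X | y in RO].

Definition stationary (V : completeNormedModType R) (ip : V -> V -> R)
    (RO : set (plane R)) (gj : plane R -> V) :=
  forall X, 0 <= dJinfty ip RO gj X.

End Hilbert.

(* Main.v *)
Require Import Defs.
From HB Require Import structures.
From mathcomp Require Import all_boot all_order all_algebra.
From mathcomp Require Import all_classical all_reals all_analysis.
From mathcomp Require Import ring lra.

Set Implicit Arguments.
Unset Strict Implicit.
Unset Printing Implicit Defensive.
Import Order.TTheory GRing.Theory Num.Theory.
Import numFieldNormedType.Exports.
Local Open Scope classical_set_scope.
Local Open Scope ring_scope.

(** The semi-derivative in direction X is the support function of the set H of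
    gradients, so stationarity says that this support function is nowhere
    negative, and the theorem is the separation theorem for a point and a
    closed convex set.

    If 0 lies in the closed hull of H, then for any X the half-space on which
    the pairing with X is at most the supremum over H contains H, hence its
    hull, hence 0 by Cauchy-Schwarz; so the supremum is nonnegative
    ([support_function_ge0]).  Conversely, completeness of the Hilbert space
    gives a point v of smallest norm in the closed hull, and minimality means
    that every z of the hull satisfies |v|^2 <= (z, v) ([min_norm_point]).  In
    the direction - v the support function is then at most - |v|^2, so
    stationarity forces v = 0.

    The converse needs H to be nonempty: the supremum over the empty set is 0,
    which would make the empty H stationary.  This is where the geometry and
    the state enter: the closure of the domain is compact and x |-> Psi(x, u x)
    is continuous on it, so the maximum is attained ([active_set_nonempty]).

    The hull may be unbounded, so an almost minimal point would not separate
    uniformly: the error of the one-sided derivative grows with the distance to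
    z.  Hence the exact minimal point, from a Cauchy argument. *)

(** * Convex hulls *)

Section ConvexHull.
Variables (R : realType) (V : lmodType R).
Implicit Types (x y : V) (A : set V).

Lemma segmentE (t : R) x y : x + t *: (y - x) = (1 - t) *: x + t *: y.
Proof. by rewrite scalerBr scalerBl scale1r addrA addrAC. Qed.

Lemma sub_convex_hull A : A `<=` convex_hull A.
Proof.
move=> x Ax; exists 1%N, (fun=> 1), (fun=> x); split=> //.
- by rewrite big_ord1.
- by rewrite big_ord1 scale1r.
Qed.

Lemma convex_hull_convex A (t : R) x y : 0 <= t <= 1 ->
  convex_hull A x -> convex_hull A y -> convex_hull A (x + t *: (y - x)).
Proof.
move=> /andP[t0 t1] [n [c [z [c0 c1 Az ->]]]] [m [d [w [d0 d1 Aw ->]]]].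
exists (n + m)%N.
exists (fun i : 'I_(n + m) => match fintype.split i with inl j => (1 - t) * c j
                                                       | inr j => t * d j end).
exists (fun i : 'I_(n + m) => match fintype.split i with inl j => z j
                                                       | inr j => w j end).
split.
- by move=> i; case: (fintype.split i) => j; rewrite mulr_ge0// subr_ge0.
- rewrite big_split_ord/=.
  under eq_bigr do rewrite (unsplitK (inl _)).
  under [X in _ + X]eq_bigr do rewrite (unsplitK (inr _)).
  by rewrite -!mulr_sumr c1 d1 !mulr1 subrK.
- by move=> i; case: (fintype.split i).
- rewrite big_split_ord/=.
  under [in RHS]eq_bigr do rewrite (unsplitK (inl _)) -scalerA.
  under [X in _ = _ + X]eq_bigr do rewrite (unsplitK (inr _)) -scalerA.
  by rewrite -!scaler_sumr segmentE.
Qed.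

End ConvexHull.

(** * Hilbert spaces *)

Section Hilbert.
Variables (R : realType) (V : completeNormedModType R) (ip : V -> V -> R).
Hypothesis ipH : Hilbert_product ip.
Implicit Types (x y z : V) (A : set V).

Let ipC x y : ip x y = ip y x.
Proof. by case: ipH. Qed.

Let ipxx x : ip x x = `|x| ^+ 2.
Proof. by case: ipH. Qed.

Let ip_linear y (a : R) x x' : ip (a *: x + x') y = a * ip x y + ip x' y.
Proof. by case: ipH. Qed.

Let ipDl x x' y : ip (x + x') y = ip x y + ip x' y.
Proof. by rewrite -[x]scale1r ip_linear mul1r scale1r. Qed.

Let ip0l y : ip 0 y = 0.
Proof. by have := ip_linear y (-1) 0 0; rewrite scaler0 addr0; lra. Qed.

Let ipZl (a : R) x y : ip (a *: x) y = a * ip x y.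
Proof. by rewrite -[a *: x]addr0 ip_linear ip0l addr0. Qed.

Let ipNl x y : ip (- x) y = - ip x y.
Proof. by rewrite -scaleN1r ipZl mulN1r. Qed.

Lemma normD_sqr x y : `|x + y| ^+ 2 = `|x| ^+ 2 + 2 * ip x y + `|y| ^+ 2.
Proof. by rewrite -!ipxx ipDl !(ipC _ (x + y)) !ipDl (ipC y x); ring. Qed.

(** Once the norm is known to come from the product, Cauchy-Schwarz is the
    triangle inequality squared. *)
Lemma Cauchy_Schwarz x y : ip x y <= `|x| * `|y|.
Proof.
have : `|x + y| ^+ 2 <= (`|x| + `|y|) ^+ 2.
  by rewrite lerXn2r ?nnegrE ?addr_ge0// ler_normD.
by rewrite normD_sqr sqrrD -mulr_natl; lra.
Qed.

Lemma parallelogram x y :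
  `|x - y| ^+ 2 + `|x + y| ^+ 2 = 2 * `|x| ^+ 2 + 2 * `|y| ^+ 2.
Proof. by rewrite !normD_sqr normrN (ipC x (- y)) ipNl (ipC y); ring. Qed.

Lemma ip_suml n (c : 'I_n -> R) (z : 'I_n -> V) y :
  ip (\sum_i c i *: z i) y = \sum_i c i * ip (z i) y.
Proof.
apply: (big_ind2 (fun v r => ip v y = r)) => [|v r v' r' <- <-|i _].
- exact: ip0l.
- exact: ipDl.
- exact: ipZl.
Qed.

Lemma convex_hull_ip_le A y (s : R) : (forall z, A z -> ip z y <= s) ->
  forall z, convex_hull A z -> ip z y <= s.
Proof.
move=> As _ [n [c [w [c0 c1 Aw ->]]]].
rewrite ip_suml -[s]mul1r -c1 mulr_suml.
by apply: ler_sum => i _; rewrite ler_wpM2l ?As.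
Qed.

Lemma closure_normP A x :
  closure A x <-> forall e : R, 0 < e -> exists2 z, A z & `|x - z| < e.
Proof.
split=> [Ax e e0|Ax B].
- have [z [Az xz]] := Ax _ (nbhsx_ballx x e e0).
  by exists z => //; rewrite -ball_normE in xz.
- rewrite -nbhs_ballE => -[e /= e0 xeB]; have [z Az xz] := Ax e e0.
  by exists z; split=> //; apply: xeB; rewrite -ball_normE.
Qed.

(** A filter of almost minimisers is Cauchy: the midpoint of two of them has
    norm at least d, so the parallelogram law leaves little room for their
    difference.  At its limit v, minimality along the segment from v to z has
    a nonnegative one-sided derivative. *)
Lemma min_norm_point A : A !=set0 ->
  (forall (t : R) x y, 0 <= t <= 1 -> A x -> A y -> A (x + t *: (y - x))) ->
  exists2 v, closure A v & forall z, A z -> `|v| ^+ 2 <= ip z v.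
Proof.
move=> [x0 Ax0] Aconv.
pose N := [set `|x| | x in A]; pose d := inf N.
have N0 : N !=set0 by exists `|x0|, x0.
have d_ge0 : 0 <= d by apply: lb_le_inf => // _ [x _ <-].
have d_le x : A x -> d <= `|x|.
  by move=> Ax; apply: ge_inf; [exists 0 => _ [y _ <-]|exists x].
have d_near e : 0 < e -> exists2 x, A x & `|x| < d + e.
  move=> e0; have Ninf : has_inf N by split=> //; exists 0 => _ [y _ <-].
  by have [_ [x Ax <-] xe] := inf_adherent e0 Ninf; exists x.
pose near_min e := A `&` [set x | `|x| < d + e].
pose F := filter_from [set e : R | 0 < e] near_min.
have FF : ProperFilter F.
  apply: filter_from_proper; last by move=> e /d_near[x Ax xe]; exists x.
  apply: filter_from_filter; first by exists 1 => /=.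
  move=> e e' /= e0 e'0; exists (Num.min e e') => /=.
    by rewrite lt_min e0.
  by move=> x [Ax /=]; rewrite -ltrBlDl lt_min => /andP[xe xe'];
    split; split=> //=; rewrite -ltrBlDl.
have Fcauchy : cauchy_ex F.
  move=> r /= r0.
  (* two points of norm below d + e are within 4 e (2 d + e) in square *)
  pose e := Num.min 1 (r ^+ 2 / (4 * (2 * d + 1) + 1)).
  have c0 : 0 < 4 * (2 * d + 1) + 1 by lra.
  have e0 : 0 < e by rewrite lt_min ltr01 divr_gt0// exprn_gt0.
  have e1 : e <= 1 by rewrite ge_min lexx.
  have er : e * (4 * (2 * d + 1) + 1) <= r ^+ 2.
    by rewrite -ler_pdivlMr// ge_min lexx orbT.
  have [x Ax xe] := d_near _ e0.
  exists x; exists e => //= y [Ay /= ye].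
  rewrite -ball_normE /=.
  have mid : 2 * d <= `|x + y|.
    have /d_le : A (x + 2^-1 *: (y - x)) by apply: Aconv => //; lra.
    have -> : x + 2^-1 *: (y - x) = 2^-1 *: (x + y).
      rewrite scalerBr scalerDr addrCA addrC; congr (_ + _).
      by rewrite -[X in X - _]scale1r -scalerBl; congr (_ *: _); lra.
    by rewrite normrZ ger0_norm ?invr_ge0//; lra.
  have := parallelogram x y.
  have : (2 * d) ^+ 2 <= `|x + y| ^+ 2 by rewrite lerXn2r ?nnegrE//; lra.
  have : `|x| ^+ 2 <= (d + e) ^+ 2 by rewrite lerXn2r ?nnegrE//; lra.
  have : `|y| ^+ 2 <= (d + e) ^+ 2 by rewrite lerXn2r ?nnegrE//; lra.
  move=> hy hx hm hp.
  rewrite -(ltr_pXn2r (ltn0Sn 1)) ?nnegrE//; last exact: ltW.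
  apply: lt_le_trans er; have := ler_wpM2l (ltW e0) e1; lra.
have /cauchy_exP/cauchy_cvgP Fcvg := Fcauchy.
set v := lim F.
have v_near e : 0 < e -> exists x, [/\ A x, `|v - x| < e & `|x| < d + e].
  move=> e0; have Fv : F --> v by exact: Fcvg.
  have Fb : F (ball v e) by apply: Fv; exact: nbhsx_ballx.
  have Fe : F (near_min e) by exists e.
  have [x [[Ax xe] vx]] := filter_ex (filterI Fe Fb).
  by exists x; split=> //; rewrite -ball_normE in vx.
have v_le : `|v| <= d.
  apply/ler_addgt0Pr => e e0.
  have [x [_ vx xd]] := v_near (e / 2) (divr_gt0 e0 (ltr0n _ 2)).
  rewrite -[v](subrK x); have := ler_normD (v - x) x; lra.
exists v.
  by apply/closure_normP => e /v_near[x [Ax vx _]]; exists x.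
move=> z Az.
have seg (t : R) : 0 <= t <= 1 -> d <= `|v + t *: (z - v)|.
  move=> t01; apply/ler_addgt0Pr => e e0; have [x [Ax vx _]] := v_near e e0.
  have Ap : A (x + t *: (z - x)) by exact: Aconv.
  apply: le_trans (d_le _ Ap) _.
  have -> : x + t *: (z - x) = (v + t *: (z - v)) + (1 - t) *: (x - v).
    by rewrite !segmentE scalerBr [RHS]addrC subrKA.
  apply: le_trans (ler_normD _ _) _; rewrite lerD2l normrZ (distrC x).
  have : `|1 - t| <= 1 by rewrite ger0_norm; lra.
  by move=> /(ler_wpM2r (normr_ge0 (v - x))); lra.
have zv : ip z v = ip v (z - v) + `|v| ^+ 2.
  by rewrite (ipC v) ipDl ipNl ipxx subrK.
rewrite zv lerDr.
have slope (t : R) : 0 < t <= 1 -> 0 <= 2 * ip v (z - v) + t * `|z - v| ^+ 2.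
  move=> /andP[t0 t1]; have := seg t; rewrite (ltW t0) t1 => /(_ isT) dt.
  have : `|v| ^+ 2 <= `|v + t *: (z - v)| ^+ 2.
    by rewrite lerXn2r ?nnegrE//; exact: le_trans dt.
  rewrite normD_sqr (ipC v) ipZl (ipC _ v) normrZ exprMn (ger0_norm (ltW t0)).
  rewrite -(pmulr_rge0 _ t0) => h; lra.
rewrite leNgt; apply/negP => neg.
(* the quadratic term is at most half of the linear one in absolute value *)
pose t := Num.min 1 (- ip v (z - v) / (`|z - v| ^+ 2 + 1)).
have c0 : 0 < `|z - v| ^+ 2 + 1 by rewrite ltr_wpDl// exprn_ge0.
have t01 : 0 < t <= 1.
  by rewrite ge_min lexx andbT lt_min ltr01 divr_gt0// oppr_gt0.
have : t * (`|z - v| ^+ 2 + 1) <= - ip v (z - v).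
  by rewrite -ler_pdivlMr// ge_min lexx orbT.
have := slope t t01; case/andP: t01 => *; lra.
Qed.

Lemma support_function_ge0 A y : closure (convex_hull A) 0 ->
  0 <= sup [set ip z y | z in A].
Proof.
move=> /closure_normP A0; set S := [set _ | _ in _].
have [Ssup|/sup_out ->//] := pselect (has_sup S).
have Sle z : A z -> ip z y <= sup S.
  by move=> Az; apply: ub_le_sup; [case: Ssup|exists z].
apply/ler_addgt0Pr => e e0.
have y1 : 0 < `|y| + 1 by rewrite ltr_wpDl.
have [z Az] := A0 (e / (`|y| + 1)) (divr_gt0 e0 y1).
rewrite sub0r normrN ltr_pdivlMr// => ze.
have := convex_hull_ip_le Sle Az.
have := Cauchy_Schwarz (- z) y; rewrite ipNl normrN.
have := normr_ge0 z; lra.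
Qed.

Lemma support_function_separation A : A !=set0 ->
  (forall y, 0 <= sup [set ip z y | z in A]) -> closure (convex_hull A) 0.
Proof.
move=> [a Aa] Asup.
have hull0 : convex_hull A !=set0 by exists a; exact: sub_convex_hull.
have [v Av vmin] := min_norm_point hull0 (@convex_hull_convex _ _ A).
suff <- : v = 0 by [].
have : sup [set ip z (- v) | z in A] <= - `|v| ^+ 2.
  apply: ge_sup; first by exists (ip a (- v)), a.
  move=> _ [z Az <-]; rewrite ipC ipNl ipC lerN2.
  by apply: vmin; exact: sub_convex_hull.
move=> /(le_trans (Asup _)); rewrite oppr_ge0 => v2.
apply/eqP; rewrite -normr_eq0 -sqrf_eq0.
by rewrite eq_le v2 exprn_ge0.
Qed.

End Hilbert.

(** * Attainment of the maximum *)

Section Attainment.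
Variable R : realType.

Lemma compact_closure_plane (A : set (plane R)) :
  bounded_set A -> compact (closure A).
Proof.
move=> [M0 [_ /(_ (M0 + 1))]]; rewrite ltrDl ltr01 => /(_ isT).
set M := M0 + 1 => AM.
have box : compact (`[- M, M]%classic `*` `[- M, M]%classic : set (plane R)).
  by apply: compact_setX; exact: segment_compact.
apply: (subclosed_compact _ box); first exact: closed_closure.
have /closure_id -> := compact_closed (@norm_hausdorff _ (R * R)%type) box.
apply: closureS => x Ax; have := AM x Ax.
rewrite /= prod_normE ge_max !ler_norml => /andP[x1 x2].
by split; rewrite /= in_itv.
Qed.

Lemma active_set_nonempty (Om : set (plane R)) (Psi : plane R -> R -> R)
    (u : plane R -> R) : Om !=set0 -> bounded_set Om ->
  continuous (fun z : plane R * R => Psi z.1 z.2) ->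
  {within closure Om, continuous u} -> active_set Om Psi u !=set0.
Proof.
move=> [x0 Omx0] /compact_closure_plane Omc Psic uc.
have Om0 : closure Om !=set0 by exists x0; exact: subset_closure.
have gc : {within closure Om, continuous (fun x => Psi x (u x))}.
  move/subspace_continuousP: uc => uc; apply/subspace_continuousP => x Omx.
  have : (z, u z) @[z --> within (closure Om) (nbhs x)] --> (x, u x).
    apply: (@cvg_pair _ _ _ _ (nbhs x) (nbhs (u x)) _ _ _ idfun u) (uc x Omx).
    exact: cvg_within.
  by move=> xu B /(Psic (x, u x)) /xu.
have [c] := compact_EVT_max Om0 Omc gc.
rewrite inE => Omc' cmax; exists c; split=> //.
have ub x : [set Psi x (u x) | x in closure Om] x -> x <= Psi c (u c).
  by move=> [y Omy <-]; apply: cmax; rewrite inE.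
apply/eqP; rewrite eq_le; apply/andP; split.
- by apply: ub_le_sup; [exists (Psi c (u c))|exists c].
- by apply: ge_sup => //; exists (Psi c (u c)), c.
Qed.

End Attainment.

Theorem lemma3p5 (R : realType)
  (D : set (plane R)) (D_open : open D) (D_bounded : bounded_set D)
  (Om Ga : set (plane R)) (Om_Xi : Xi D (Om, Ga))
  (beta : R -> R) (blo bhi k K : R)
  (beta_cond : beta_conditions beta blo bhi k K)
  (q q0 : R) (q_range : 2 < q < q0)
  (q0_cond : exponent_conditions Om Ga k K q0)
  (f : plane R -> R) (f_W1 : W1 D q f)
  (Psi : plane R -> R -> R)
  (Psi_C1 : Cn 1 (fun z : plane R * R => Psi z.1 z.2))
  (u : plane R -> R) (u_state : is_state Om Ga beta f q u)
  (p : plane R -> plane R -> R)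
  (p_adjoint : forall y, closure Om y -> is_adjoint Om Ga beta Psi q u y (p y))
  (V : completeNormedModType R) (ip : V -> V -> R)
  (ip_Hilbert : Hilbert_product ip)
  (ev : V -> plane R -> plane R) (ev_fields : Lipschitz_field_space D ev)
  (gj : plane R -> V)
  (gj_Riesz : forall y, closure Om y -> forall X : V,
     ip (gj y) X = dj D Om beta f Psi u y (p y) (ev X)) :
  let RO := active_set Om Psi u in
  let H := [set gj y | y in RO] in
  stationary ip RO gj <-> closure (convex_hull H) 0.
Proof.
move=> RO H.
have supE X : dJinfty ip RO gj X = sup [set ip h X | h in H].
  rewrite /dJinfty; congr sup; rewrite /H; apply/seteqP; split.
  - by move=> _ [y ROy <-]; exists (gj y) => //; exists y.
  - by move=> _ [_ [y ROy <-] <-]; exists y.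
split=> [st|H0 X]; last first.
  by rewrite supE; exact: (support_function_ge0 ip_Hilbert).
apply: (support_function_separation ip_Hilbert); last first.
  by move=> X; rewrite -supE; exact: st.
have [_ _ [[_ _ Om0 Omb _] _ _ _]] := Om_Xi.
have [_ uc _] := u_state.
have Psic : continuous (fun z : plane R * R => Psi z.1 z.2).
  by move=> z; apply: differentiable_continuous; exact: (proj1 Psi_C1).
have [y ROy] := active_set_nonempty Om0 Omb Psic uc.
by exists (gj y), y.
Qed.
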